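(* (In $\mathbf{ZF}+\mathbf{DC}$.) Let $E$ be a normed space. If $E$ does not contain any asymptotically isometric copy of $\ell^1(\mathbb N)$, then the dual unit ball $\Gamma_{E'}$ is weak* block compact.
   Context: Normed spaces are real and not assumed complete. The base theory is Zermelo–Fraenkel set theory $\mathbf{ZF}$ without choice. $\mathbf{DC}$ is the axiom of Dependent Choices: if $X$ is a non-empty set and $R\subseteq X\times X$ satisfies $\forall x\in X\ \exists y\in X\ xRy$, then there is a sequence $(x_n)_{n\in\mathbb N}$ of $X$ with $x_nRx_{n+1}$ for all $n$. For a normed space $E$, $\Gamma_E$ is its closed unit ball, $E'$ is its continuous dual with the dual norm, and $\Gamma_{E'}$ is the closed unit ball of $E'$. $E$ contains an asymptotically isometric copy of $\ell^1(\mathbb N)$ if there exist a sequence $(a_n)_{n\in\mathbb N}$ of $\Gamma_E$ and a sequence $(\delta_n)_{n\in\mathbb N}$ of the open interval $]0,1[$ converging to $1$ such that for every finite sequence $(\lambda_i)_{0\le i\le n}$ of real numbers, $$\sum_{0\le i\le n}\delta_i|\lambda_i|\le\Big\|\sum_{0\le i\le n}\lambda_i a_i\Big\|.$$ A sequence $(b_n)_{n\in\mathbb N}$ of a real vector space is a normalized block sequence of $(x_n)_{n\in\mathbb N}$ if there are pairwise disjoint finite subsets $F_n$ $(n\in\mathbb N)$ of $\mathbb N$ and real numbers $(\lambda_i)_{i\in\mathbb N}$ such that for every $n$, $b_n=\sum_{i\in F_n}\lambda_i x_i$ and $\sum_{i\in F_n}|\lambda_i|=1$. $\Gamma_{E'}$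 is weak* block compact if every sequence of $\Gamma_{E'}$ has a normalized block sequence which converges in $E'$ for the weak* topology (i.e. pointwise on $E$). *)

(* Defs.v *)
From Stdlib Require Import Reals List FunctionalExtensionality.
From Coquelicot Require Import Coquelicot.
Open Scope R_scope.

(* Real normed spaces are [NormedModule R_AbsRing]: no
   completeness, and (unlike MathComp's normed modules, which are choiceTypes)
   no choice operator on the carrier, so nothing here presupposes any form of
   the axiom of choice. *)

Definition dependent_choices : Prop :=
  forall (X : Type) (Rel : X -> X -> Prop),
    inhabited X ->
    (forall x : X, exists y : X, Rel x y) ->
    exists u : nat -> X, forall n : nat, Rel (u n) (u (S n)).

Section FunctionSpace.

Variables (K : Ring) (T : Type) (V : ModuleSpace K).

Definition fct_AbelianMonoid_mixin : AbelianMonoid.mixin_of (T -> V).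
Proof.
  apply (AbelianMonoid.Mixin (T -> V)
           (fun f g t => plus (f t) (g t)) (fun _ => zero)); intros;
    apply functional_extensionality; intros t.
  - apply plus_comm.
  - apply plus_assoc.
  - apply plus_zero_r.
Defined.

Definition fct_AbelianMonoid : AbelianMonoid :=
  AbelianMonoid.Pack (T -> V) fct_AbelianMonoid_mixin (T -> V).

Definition fct_AbelianGroup_mixin : AbelianGroup.mixin_of fct_AbelianMonoid.
Proof.
  apply (AbelianGroup.Mixin fct_AbelianMonoid
           (fun (f : T -> V) (t : T) => opp (f t))).
  intros f; apply functional_extensionality; intros t.
  exact (plus_opp_r (f t)).
Defined.

Definition fct_AbelianGroup : AbelianGroup :=
  AbelianGroup.Pack (T -> V)
    (AbelianGroup.Class (T -> V) fct_AbelianMonoid_mixin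
       fct_AbelianGroup_mixin) (T -> V).

Definition fct_ModuleSpace_mixin : ModuleSpace.mixin_of K fct_AbelianGroup.
Proof.
  apply (ModuleSpace.Mixin K fct_AbelianGroup
           (fun (c : K) (f : T -> V) (t : T) => scal c (f t))); intros;
    apply functional_extensionality; intros t.
  - apply scal_assoc.
  - apply scal_one.
  - exact (scal_distr_l x (u t) (v t)).
  - exact (scal_distr_r x y (u t)).
Defined.

Definition fct_ModuleSpace : ModuleSpace K :=
  ModuleSpace.Pack K (T -> V)
    (ModuleSpace.Class K (T -> V) (AbelianGroup.class fct_AbelianGroup)
       fct_ModuleSpace_mixin) (T -> V).

End FunctionSpace.

Definition contains_asymptotically_isometric_l1
    (E : NormedModule R_AbsRing) : Prop :=
  exists (a : nat -> E) (delta : nat -> R),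
    (forall n, norm (a n) <= 1) /\
    (forall n, 0 < delta n < 1) /\
    is_lim_seq delta 1 /\
    forall (n : nat) (lambda : nat -> R),
      sum_n (fun i => delta i * Rabs (lambda i)) n
        <= norm (sum_n (fun i => scal (lambda i) (a i)) n).

(* A finite subset of nat is given by a duplicate-free list. *)
Definition normalized_block_sequence {V : ModuleSpace R_Ring}
    (x b : nat -> V) : Prop :=
  exists (F : nat -> list nat) (lambda : nat -> R),
    (forall n, NoDup (F n)) /\
    (forall m n, m <> n -> forall i, In i (F m) -> ~ In i (F n)) /\
    forall n,
      b n = Iter.iter plus zero (F n) (fun i => scal (lambda i) (x i)) /\
      Iter.iter Rplus 0 (F n) (fun i => Rabs (lambda i)) = 1.

(* The continuous dual is the subspace of the real vector space of all
   functions E -> R cut out by Coquelicot's [is_linear], which includes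
   boundedness. *)
Definition functions_on (E : NormedModule R_AbsRing) : ModuleSpace R_Ring :=
  fct_ModuleSpace R_Ring E R_ModuleSpace.

Definition in_dual (E : NormedModule R_AbsRing) (f : E -> R) : Prop :=
  is_linear (V := R_NormedModule) f.

Definition dual_norm (E : NormedModule R_AbsRing) (f : E -> R) : Rbar :=
  Lub_Rbar (fun r => exists x : E, norm x <= 1 /\ r = Rabs (f x)).

Definition in_dual_unit_ball (E : NormedModule R_AbsRing) (f : E -> R) : Prop :=
  in_dual E f /\ Rbar_le (dual_norm E f) 1.

Definition weak_star_converges (E : NormedModule R_AbsRing)
    (b : nat -> E -> R) (f : E -> R) : Prop :=
  forall x : E, is_lim_seq (fun n => b n x) (f x).

Definition dual_ball_weak_star_block_compact
    (E : NormedModule R_AbsRing) : Prop :=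
  forall f : nat -> E -> R,
    (forall n, in_dual_unit_ball E (f n)) ->
    exists b : nat -> E -> R,
      normalized_block_sequence (V := functions_on E) f b /\
      exists g : E -> R, in_dual E g /\ weak_star_converges E b g.

(* Main.v *)
Require Import Defs.
From Stdlib Require Import Reals List Lra Lia Classical FunctionalExtensionality.
From Coquelicot Require Import Coquelicot.

(** Let [f_n] be a sequence of functionals of norm at most 1.  Block sequences of
    [f] with nonnegative coefficients are handled through decreasing sequences
    [K_0], [K_1], ... of nonempty convex sets of functionals ([chain]), the first
    one being [tail_hull f], where [K_k] is the convex hull of the [f_i] with
    [k <= i].  Unlike blocks, chains compose trivially: a subchain of a subchain
    is a subchain, and a diagonal of nested chains is a chain.

    The oscillation of a chain [K] at [x] is the limit of the diameters of the
    sets of values [g x], [g] in [K_k].  Let [rho] be the supremum of the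
    oscillations over the unit ball.  Dependent choice and a diagonal argument
    give a subchain [K] of [tail_hull f] no subchain of which has a smaller [rho]
    ([oscillation_minimal_subchain]).

    If [rho <= 0], any selection [b_n] in [K_n] is pointwise Cauchy on the ball,
    hence weak* convergent ([weak_star_limit]), and it can be made with
    successive supports ([block_selection]).

    If [0 < rho], the space contains the forbidden copy of l1
    ([l1_copy_of_minimal]).  Given finitely many subchains of [K], their average
    is again a subchain, so it oscillates by almost [rho] at some [x] of the
    ball; as no chain below [K] oscillates by more than [rho] there, each of the
    averaged subchains oscillates by almost [rho] at [x], between nearly the
    same two values [lo < hi] ([simultaneous_split]).  Each of them is split into
    a part where [hi <= g x] and a part where [g x <= lo], and the step is
    repeated with these parts.  The resulting points [a_i] are independent: any
    pattern of high and low values is taken on them by members of every [K_k]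
    ([independent_points]).  Hence for [y] the combination of the [a_i] with
    coefficients [c_i], taking opposite patterns shows that [K] oscillates at [y]
    by at least the sum of the [|c_i| (hi_i - lo_i)], where [hi_i - lo_i] is
    close to [rho]; by homogeneity it oscillates by at most [rho * norm y]
    ([spread_le_norm]).  Dividing by [rho] gives constants tending to 1: they are
    asymptotically isometric because [rho], and not the norms of the
    functionals, bounds the oscillation at [y]. *)

(** * Dependent choice *)

Inductive reachable {X : Type} (P : nat -> X -> Prop) (Rel : nat -> X -> X -> Prop)
  : nat -> X -> Prop :=
| reachable_start x : P 0%nat x -> reachable P Rel 0 x
| reachable_step n x y :
    reachable P Rel n x -> Rel n x y -> P (S n) y -> reachable P Rel (S n) y.

Lemma reachable_history {X : Type} (P : nat -> X -> Prop)
  (Rel : nat -> X -> X -> Prop) n x :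
  reachable P Rel n x ->
  exists v : nat -> X, v n = x /\ (forall i, (i <= n)%nat -> P i (v i)) /\
    forall i, (i < n)%nat -> Rel i (v i) (v (S i)).
Proof.
  induction 1 as [x Hx | n x y _ [v [Hv [HP HR]]] Hxy Hy].
  - exists (fun _ => x). split; [easy|]. split; [|lia].
    intros i Hi. now replace i with 0%nat by lia.
  - exists (fun i => if Nat.leb i n then v i else y). split; [|split].
    + now rewrite (proj2 (Nat.leb_gt (S n) n)) by lia.
    + intros i Hi. destruct (Nat.leb_spec i n); auto.
      now replace i with (S n) by lia.
    + intros i Hi. rewrite (proj2 (Nat.leb_le i n)) by lia.
      destruct (Nat.leb_spec (S i) n); [apply HR; lia|].
      replace i with n by lia. now rewrite Hv.
Qed.

(** The raw principle controls neither where the sequence starts nor which step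
    it is at.  Running it on the pairs (stage, state) that can be reached from
    the initial state cures both: a finite history is put in front of the
    sequence that it returns. *)
Lemma dependent_choices_indexed (dc : dependent_choices) {X : Type}
  (P : nat -> X -> Prop) (Rel : nat -> X -> X -> Prop) :
  (exists x, P 0%nat x) ->
  (forall n x, P n x -> exists y, P (S n) y /\ Rel n x y) ->
  exists u : nat -> X, forall n, P n (u n) /\ Rel n (u n) (u (S n)).
Proof.
  intros [x0 H0] Hstep.
  destruct (dc {s : nat * X | reachable P Rel (fst s) (snd s)}
    (fun s t => fst (proj1_sig t) = S (fst (proj1_sig s)) /\
       Rel (fst (proj1_sig s)) (snd (proj1_sig s)) (snd (proj1_sig t))))
    as [u Hu].
  - exact (inhabits (exist (fun s => reachable P Rel (fst s) (snd s)) (0%nat, x0)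
      (reachable_start P Rel x0 H0))).
  - intros [[n x] Hx]; simpl in *.
    destruct (Hstep n x) as [y [Hy HR]].
    { destruct Hx; auto. }
    exists (exist (fun s => reachable P Rel (fst s) (snd s)) (S n, y)
      (reachable_step P Rel n x y Hx HR Hy)). now split.
  - set (n0 := fst (proj1_sig (u 0%nat))).
    assert (Hn : forall j, fst (proj1_sig (u j)) = (n0 + j)%nat).
    { induction j as [|j IH]; [unfold n0; lia|].
      rewrite (proj1 (Hu j)), IH. lia. }
    destruct (reachable_history P Rel _ _ (proj2_sig (u 0%nat)))
      as [v [Hv [HvP HvR]]].
    fold n0 in Hv, HvP, HvR.
    exists (fun i => if Nat.leb i n0 then v i else snd (proj1_sig (u (i - n0)%nat))).
    assert (Hlate : forall i, (n0 <= i)%nat ->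
      (if Nat.leb i n0 then v i else snd (proj1_sig (u (i - n0)%nat)))
      = snd (proj1_sig (u (i - n0)%nat))).
    { intros i Hi. destruct (Nat.leb_spec i n0); auto.
      replace i with n0 by lia. rewrite Nat.sub_diag. exact Hv. }
    assert (HuP : forall j, P (n0 + j)%nat (snd (proj1_sig (u j)))).
    { intros j. rewrite <- Hn. destruct (proj2_sig (u j)); auto. }
    intros n. destruct (Nat.le_gt_cases n0 n) as [Hle|Hlt].
    + rewrite !Hlate by lia. split.
      * replace n with (n0 + (n - n0))%nat at 1 by lia. apply HuP.
      * replace (S n - n0)%nat with (S (n - n0)) by lia.
        generalize (proj2 (Hu (n - n0)%nat)). rewrite Hn.
        now replace (n0 + (n - n0))%nat with n by lia.
    + rewrite !(proj2 (Nat.leb_le _ _)) by lia. split; [apply HvP|apply HvR]; lia.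
Qed.

Lemma countable_choice (dc : dependent_choices) {X : Type} (P : nat -> X -> Prop) :
  (forall n, exists x, P n x) -> exists u : nat -> X, forall n, P n (u n).
Proof.
  intros H.
  destruct (dependent_choices_indexed dc P (fun _ _ _ => True)) as [u Hu]; auto.
  - intros n _ _. destruct (H (S n)) as [y Hy]. now exists y.
  - exists u. intros n. apply Hu.
Qed.

(** * Chains of convex sets of functionals *)

Section Chains.

Variable E : NormedModule R_AbsRing.

Definition unit_functional (g : E -> R) : Prop :=
  (forall x y, g (plus x y) = g x + g y) /\
  (forall (t : R) x, g (scal t x) = t * g x) /\
  (forall x, Rabs (g x) <= norm x).

Definition midpoint (g h : E -> R) : E -> R := fun x => (g x + h x) / 2.

(** Closure under midpoints is the only form of convexity that the averaging
    argument uses, and it is simpler to check than full convexity. *)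
Record chain (K : nat -> (E -> R) -> Prop) : Prop := {
  chain_nonempty : forall k, exists g, K k g;
  chain_decreasing : forall k g, K (S k) g -> K k g;
  chain_midpoint : forall k g h, K k g -> K k h -> K k (midpoint g h);
  chain_unit : forall k g, K k g -> unit_functional g }.

Definition subchain (H K : nat -> (E -> R) -> Prop) : Prop :=
  chain H /\ forall k g, H k g -> K k g.

(** Since the [K k] decrease, this implies that the oscillation of [K] at [x],
    that is the limit of the diameters, is at least [r], and it holds when the
    oscillation exceeds [r]; it avoids naming that limit. *)
Definition oscillates (K : nat -> (E -> R) -> Prop) (x : E) (r : R) : Prop :=
  forall k, exists g h, K k g /\ K k h /\ r < g x - h x.

Lemma chain_le K : chain K ->
  forall j k g, (j <= k)%nat -> K k g -> K j g.
Proof.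
  intros HK j k g Hjk. induction Hjk; auto.
  intros Hg. apply IHHjk. now apply (chain_decreasing K HK).
Qed.

Lemma subchain_refl K : chain K -> subchain K K.
Proof. now split. Qed.

Lemma subchain_trans H K L : subchain H K -> subchain K L -> subchain H L.
Proof. intros [H1 H2] [H3 H4]; split; auto. Qed.

Lemma oscillates_mono H K x r s :
  (forall k, exists j, forall g, H j g -> K k g) -> s <= r ->
  oscillates H x r -> oscillates K x s.
Proof.
  intros HK Hsr Ho k. destruct (HK k) as [j Hj].
  destruct (Ho j) as [g [h [Hg [Hh Hgh]]]].
  exists g, h. repeat split; auto. lra.
Qed.

Lemma oscillates_subchain H K x r :
  subchain H K -> oscillates H x r -> oscillates K x r.
Proof.
  intros HK. apply oscillates_mono; [|lra].
  intros k. exists k. apply HK.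
Qed.

Lemma not_oscillates K x r : ~ oscillates K x r ->
  exists k, forall g h, K k g -> K k h -> g x - h x <= r.
Proof.
  intros Hn. apply not_all_ex_not in Hn as [k Hk]. exists k.
  intros g h Hg Hh. apply Rnot_lt_le. intros Hlt. apply Hk. now exists g, h.
Qed.

Lemma midpoint_unit g h :
  unit_functional g -> unit_functional h -> unit_functional (midpoint g h).
Proof.
  unfold midpoint. intros [g1 [g2 g3]] [h1 [h2 h3]]. repeat split.
  - intros x y. rewrite g1, h1. lra.
  - intros t x. rewrite g2, h2. lra.
  - intros x. specialize (g3 x). specialize (h3 x).
    apply Rabs_le_between in g3. apply Rabs_le_between in h3.
    apply Rabs_le_between. lra.
Qed.

Lemma unit_sum (g : E -> R) (c : nat -> R) (a : nat -> E) n :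
  unit_functional g ->
  g (sum_n (fun i => scal (c i) (a i)) n) = sum_n (fun i => c i * g (a i)) n.
Proof.
  intros [g1 [g2 _]]. induction n as [|n IH].
  - rewrite !sum_O. apply g2.
  - rewrite !sum_Sn, g1, IH, g2. reflexivity.
Qed.

Definition shift (n : nat) (K : nat -> (E -> R) -> Prop) :=
  fun k => K (n + k)%nat.

Lemma shift_chain n K : chain K -> chain (shift n K).
Proof.
  unfold shift. intros HK. split.
  - intros k. apply (chain_nonempty K HK).
  - intros k g Hg. apply (chain_decreasing K HK). now rewrite plus_n_Sm.
  - intros k. apply (chain_midpoint K HK).
  - intros k. apply (chain_unit K HK).
Qed.

Definition average (H K : nat -> (E -> R) -> Prop) :=
  fun k f => exists g h, H k g /\ K k h /\ f = midpoint g h.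

Lemma average_subchain H1 H2 K :
  chain K -> subchain H1 K -> subchain H2 K -> subchain (average H1 H2) K.
Proof.
  intros HK [C1 S1] [C2 S2]. split; [split|].
  - intros k. destruct (chain_nonempty _ C1 k) as [g Hg].
    destruct (chain_nonempty _ C2 k) as [h Hh].
    exists (midpoint g h), g, h. auto.
  - intros k f [g [h [Hg [Hh ->]]]]. exists g, h. repeat split.
    + now apply (chain_decreasing _ C1).
    + now apply (chain_decreasing _ C2).
  - intros k f f' [g [h [Hg [Hh ->]]]] [g' [h' [Hg' [Hh' ->]]]].
    exists (midpoint g g'), (midpoint h h'). repeat split.
    + now apply (chain_midpoint _ C1).
    + now apply (chain_midpoint _ C2).
    + apply functional_extensionality. intros x. unfold midpoint. lra.
  - intros k f [g [h [Hg [Hh ->]]]]. apply midpoint_unit.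
    + now apply (chain_unit _ C1 k).
    + now apply (chain_unit _ C2 k).
  - intros k f [g [h [Hg [Hh ->]]]]. apply (chain_midpoint _ HK); auto.
Qed.

Definition above (L : nat -> (E -> R) -> Prop) (x : E) (hi : R) :=
  fun k g => L k g /\ hi <= g x.

Definition below (L : nat -> (E -> R) -> Prop) (x : E) (lo : R) :=
  fun k g => L k g /\ g x <= lo.

Lemma above_subchain L K x hi : subchain L K ->
  (forall k, exists g, above L x hi k g) -> subchain (above L x hi) K.
Proof.
  intros [C S] Hne. split; [split; auto|].
  - intros k g [Hg Hx]. split; auto. now apply (chain_decreasing _ C).
  - intros k g h [Hg Hgx] [Hh Hhx]. split.
    + now apply (chain_midpoint _ C).
    + unfold midpoint. lra.
  - intros k g [Hg _]. now apply (chain_unit _ C k).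
  - intros k g [Hg _]. auto.
Qed.

Lemma below_subchain L K x lo : subchain L K ->
  (forall k, exists g, below L x lo k g) -> subchain (below L x lo) K.
Proof.
  intros [C S] Hne. split; [split; auto|].
  - intros k g [Hg Hx]. split; auto. now apply (chain_decreasing _ C).
  - intros k g h [Hg Hgx] [Hh Hhx]. split.
    + now apply (chain_midpoint _ C).
    + unfold midpoint. lra.
  - intros k g [Hg _]. now apply (chain_unit _ C k).
  - intros k g [Hg _]. auto.
Qed.

(** * Chains whose oscillation cannot be decreased *)

(** [rho] is at once an upper bound for the oscillation of [K] on the unit ball
    and a lower bound for the supremum of the oscillation of every subchain, so
    all of them have the same supremum [rho]. *)
Definition oscillation_minimal (K : nat -> (E -> R) -> Prop) (rho : R) : Prop :=
  (forall x r, norm x <= 1 -> oscillates K x r -> r <= rho) /\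
  (forall H r, subchain H K -> r < rho ->
     exists x, norm x <= 1 /\ oscillates H x r).

Lemma oscillates_le_2 K x r :
  chain K -> norm x <= 1 -> oscillates K x r -> r <= 2.
Proof.
  intros C Hx Ho. destruct (Ho 0%nat) as [g [h [Hg [Hh Hr]]]].
  destruct (chain_unit _ C _ _ Hg) as [_ [_ Bg]].
  destruct (chain_unit _ C _ _ Hh) as [_ [_ Bh]].
  specialize (Bg x). specialize (Bh x).
  apply Rabs_le_between in Bg. apply Rabs_le_between in Bh. lra.
Qed.

Lemma oscillates_neg K x : chain K -> oscillates K x (-1).
Proof.
  intros C k. destruct (chain_nonempty _ C k) as [g Hg].
  exists g, g. repeat split; auto. lra.
Qed.

Lemma norm_zero_le_1 : norm (zero : E) <= 1.
Proof. rewrite (@norm_zero R_AbsRing E). lra. Qed.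

(** [r] is the infimum, over all subchains of [K], of the supremum of the
    oscillation on the ball, and [H] is a subchain that nearly attains it. *)
Lemma almost_minimal_subchain K eps : chain K -> 0 < eps ->
  exists H r, subchain H K /\
    (forall x s, norm x <= 1 -> oscillates H x s -> s <= r + eps) /\
    (forall L s, subchain L K -> s < r ->
       exists x, norm x <= 1 /\ oscillates L x s).
Proof.
  intros C Heps.
  set (A := fun r => forall L, subchain L K ->
              exists x, norm x <= 1 /\ oscillates L x r).
  destruct (completeness A) as [r [Hub Hlub]].
  - exists 2. intros r Hr. destruct (Hr K (subchain_refl K C)) as [x [Hx Ho]].
    now apply (oscillates_le_2 K x).
  - exists (-1). intros L HL. exists zero. split; [apply norm_zero_le_1|].
    apply oscillates_neg, HL.
  - assert (Hn : ~ A (r + eps)).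
    { intros H. apply Hub in H. lra. }
    apply not_all_ex_not in Hn as [H Hn]. apply imply_to_and in Hn as [HH Hn].
    exists H, r. split; [|split]; auto.
    + intros x s Hx Ho. apply Rnot_lt_le. intros Hlt. apply Hn.
      exists x. split; auto. revert Ho. apply oscillates_mono; [|lra].
      intros k. now exists k.
    + intros L s HL Hs. apply NNPP. intros Hno.
      assert (r <= s); [|lra]. apply Hlub. intros t Ht.
      apply Rnot_lt_le. intros Hlt. apply Hno.
      destruct (Ht L HL) as [x [Hx Ho]]. exists x. split; auto.
      revert Ho. apply oscillates_mono; [|lra]. intros k. now exists k.
Qed.

(** Near-minimizers at precision [1 / (n + 1)] form nested chains [u n], and
    their diagonal [D n := u n n] is minimal: from stage [n] on, [D] and its
    subchains are subchains of [u n], so that the near-minimality of each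
    [u (n + 1)] applies to them. *)
Lemma oscillation_minimal_subchain (dc : dependent_choices) K0 : chain K0 ->
  exists K rho, subchain K K0 /\ oscillation_minimal K rho.
Proof.
  intros C0.
  destruct (dependent_choices_indexed dc (fun _ K => subchain K K0)
    (fun n K H => subchain H K /\ exists r,
      (forall x s, norm x <= 1 -> oscillates H x s -> s <= r + / (INR n + 1)) /\
      (forall L s, subchain L K -> s < r ->
         exists x, norm x <= 1 /\ oscillates L x s))) as [u Hu].
  - exists K0. now apply subchain_refl.
  - intros n K HK.
    destruct (almost_minimal_subchain K (/ (INR n + 1))) as [H [r [HH Hr]]].
    { apply HK. }
    { apply Rinv_0_lt_compat. generalize (pos_INR n). lra. }
    exists H. split; [now apply subchain_trans with K|].
    split; auto. now exists r.
  - assert (Hc : forall n, chain (u n)) by (intros n; apply (proj1 (Hu n))).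
    assert (Hmono : forall m n k g, (m <= n)%nat -> u n k g -> u m k g).
    { intros m n k g Hmn. induction Hmn; auto. intros Hg. apply IHHmn.
      now apply (proj1 (proj2 (Hu m0))). }
    set (D := fun n => u n n).
    assert (CD : chain D).
    { unfold D. split.
      - intros k. apply (chain_nonempty _ (Hc k)).
      - intros k g Hg. apply (chain_decreasing _ (Hc k)).
        apply (Hmono k (S k)); auto.
      - intros k. apply (chain_midpoint _ (Hc k)).
      - intros k. apply (chain_unit _ (Hc k)). }
    assert (Hshift : forall n L, subchain L D -> subchain (shift n L) (u n)).
    { intros n L [CL SL]. split; [now apply shift_chain|].
      intros k g Hg. apply SL in Hg. unfold D in Hg.
      apply (chain_le _ (Hc n)) with (n + k)%nat; [lia|].
      apply (Hmono n (n + k)%nat); auto. lia. }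
    destruct (completeness (fun r => exists x, norm x <= 1 /\ oscillates D x r))
      as [rho [Hub Hlub]].
    + exists 2. intros r [x [Hx Ho]]. now apply (oscillates_le_2 D x).
    + exists (-1), zero. split; [apply norm_zero_le_1|]. now apply oscillates_neg.
    + exists D, rho. split; [|split].
      * split; auto. intros k g. apply (proj1 (Hu k)).
      * intros x r Hx Ho. apply Hub. now exists x.
      * intros L s HL Hs.
        destruct (archimed_cor1 (rho - s)) as [N [HN HN0]]; [lra|].
        destruct (Hu N) as [_ [_ [r [Hr1 Hr2]]]].
        assert (Hrho : rho <= r + / (INR N + 1)).
        { apply Hlub. intros t [x [Hx Ho]]. apply (Hr1 x); auto.
          apply (oscillates_subchain _ _ _ _ (Hshift (S N) D (subchain_refl D CD))).
          intros k. apply Ho. }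
        assert (/ (INR N + 1) < / INR N).
        { apply lt_0_INR in HN0. apply Rinv_lt_contravar; [|lra].
          apply Rmult_lt_0_compat; lra. }
        destruct (Hr2 (shift N L) s) as [x [Hx Ho]]; [auto|lra|].
        exists x. split; auto. revert Ho. apply oscillates_mono; [|lra].
        intros k. exists k. intros g. apply (chain_le _ (proj1 HL)). lia.
Qed.

Section Minimal.

Variables (K : nat -> (E -> R) -> Prop) (rho : R).
Hypothesis CK : chain K.
Hypothesis MK : oscillation_minimal K rho.

Lemma eventually_spread_le x eps : norm x <= 1 -> 0 < eps ->
  exists k, forall j g h, (k <= j)%nat -> K j g -> K j h ->
    g x - h x <= rho + eps.
Proof.
  intros Hx Heps. destruct (not_oscillates K x (rho + eps)) as [k Hk].
  - intros Ho. apply (proj1 MK) in Ho; auto. lra.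
  - exists k. intros j g h Hj Hg Hh.
    apply Hk; apply (chain_le _ CK) with j; auto.
Qed.

(** * Points on which many subchains oscillate together *)

(** At a point of the ball where the average of two subchains oscillates by
    almost [rho], so do both of them, because neither can oscillate by more than
    [rho].  For a list the averages are nested, the weights being 1/2, 1/4, ...;
    the loss [eta] depends on the length of the list, which is harmless. *)
Lemma averaging (l : list (nat -> (E -> R) -> Prop)) eps :
  (forall L, In L l -> subchain L K) -> 0 < eps ->
  exists H eta, subchain H K /\ 0 < eta /\
    forall x, norm x <= 1 -> oscillates H x (rho - eta) ->
      forall L, In L l -> oscillates L x (rho - eps).
Proof.
  intros Hl Heps. induction l as [|L1 l IH].
  - exists K, 1. split; [now apply subchain_refl|]. split; [lra|].
    intros x _ _ L [].
  - destruct IH as [H [eta [HH [Heta IH]]]]; [intros; apply Hl; now right|].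
    assert (HL1 : subchain L1 K) by (apply Hl; now left).
    set (m := Rmin eps eta).
    assert (Hm : 0 < m) by now apply Rmin_pos.
    assert (m <= eps) by apply Rmin_l.
    assert (m <= eta) by apply Rmin_r.
    exists (average L1 H), (m / 3).
    split; [now apply average_subchain|]. split; [lra|].
    intros x Hx Ho.
    destruct (eventually_spread_le x (m / 3) Hx) as [k0 Hk0]; [lra|].
    assert (Hboth : oscillates L1 x (rho - m) /\ oscillates H x (rho - m)).
    { split; intros k; destruct (Ho (max k0 k))
        as [f [f' [[g [h [Hg [Hh ->]]]] [[g' [h' [Hg' [Hh' ->]]]] Hd]]]];
      unfold midpoint in Hd.
      - exists g, g'. split; [|split].
        + apply (chain_le _ (proj1 HL1)) with (max k0 k); auto; lia.
        + apply (chain_le _ (proj1 HL1)) with (max k0 k); auto; lia.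
        + assert (h x - h' x <= rho + m / 3); [|lra].
          apply (Hk0 (max k0 k)); [lia| |]; now apply HH.
      - exists h, h'. split; [|split].
        + apply (chain_le _ (proj1 HH)) with (max k0 k); auto; lia.
        + apply (chain_le _ (proj1 HH)) with (max k0 k); auto; lia.
        + assert (g x - g' x <= rho + m / 3); [|lra].
          apply (Hk0 (max k0 k)); [lia| |]; now apply HL1. }
    destruct Hboth as [Ho1 Ho2]. intros L [<-|HL].
    + revert Ho1. apply oscillates_mono; [|lra]. intros k. now exists k.
    + apply IH; auto. revert Ho2. apply oscillates_mono; [|lra].
      intros k. now exists k.
Qed.

(** The thresholds have to be common to all the subchains.  They can be, since
    the values at [x] of all members of a late [K k] lie in an interval of length
    nearly [rho], and each subchain almost fills that interval. *)
Lemma simultaneous_split (l : list (nat -> (E -> R) -> Prop)) eps :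
  (forall L, In L l -> subchain L K) -> 0 < eps ->
  exists x hi lo, norm x <= 1 /\ rho - eps <= hi - lo /\
    forall L, In L l -> subchain (above L x hi) K /\ subchain (below L x lo) K.
Proof.
  intros Hl Heps. set (eta := eps / 5).
  assert (Heta : 0 < eta) by (unfold eta; lra).
  assert (HKl : forall L, In L (K :: l) -> subchain L K).
  { intros L [<-|HL]; auto. now apply subchain_refl. }
  destruct (averaging (K :: l) eta HKl Heta) as [H [eta' [HH [Heta' Hav]]]].
  destruct (proj2 MK H (rho - eta') HH) as [x [Hx Ho]]; [lra|].
  specialize (Hav x Hx Ho).
  destruct (eventually_spread_le x eta Hx Heta) as [k0 Hk0].
  (* The values at [x] on [K k0] lie between [p x - rho - eta] and
     [q x + rho + eta], an interval shorter than [rho + 3 * eta]. *)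
  destruct (Hav K (or_introl eq_refl) k0) as [p [q [Hp [Hq Hpq]]]].
  exists x, (p x - 2 * eta), (q x + 2 * eta).
  split; [auto|]. split; [unfold eta in *; lra|].
  intros L HL. assert (HLK := Hl L HL).
  assert (Hgh : forall k, exists g h, L k g /\ L k h /\
      p x - 2 * eta <= g x /\ h x <= q x + 2 * eta).
  { intros k.
    destruct (Hav L (or_intror HL) (max k0 k)) as [g [h [Hg [Hh Hd]]]].
    assert (HgK : K k0 g).
    { apply (chain_le _ CK) with (max k0 k); [lia|]. now apply HLK. }
    assert (HhK : K k0 h).
    { apply (chain_le _ CK) with (max k0 k); [lia|]. now apply HLK. }
    assert (p x - h x <= rho + eta) by (apply (Hk0 k0); auto).
    assert (g x - q x <= rho + eta) by (apply (Hk0 k0); auto).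
    exists g, h. repeat split; try lra;
      apply (chain_le _ (proj1 HLK)) with (max k0 k); auto; lia. }
  split; [apply above_subchain|apply below_subchain]; auto; intros k;
    destruct (Hgh k) as [g [h [Hg [Hh [H1 H2]]]]].
  - now exists g.
  - now exists h.
Qed.

(** The bound [rho] on the unit ball extends to the whole space by homogeneity. *)
Lemma spread_le_norm y r :
  (forall k, exists g h, K k g /\ K k h /\ r <= g y - h y) -> r <= rho * norm y.
Proof.
  intros Hr. destruct (Req_dec (norm y) 0) as [H0|H0].
  - destruct (Hr 0%nat) as [g [h [Hg [Hh Hd]]]].
    destruct (chain_unit _ CK _ _ Hg) as [_ [_ Bg]].
    destruct (chain_unit _ CK _ _ Hh) as [_ [_ Bh]].
    specialize (Bg y). specialize (Bh y). rewrite H0 in *.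
    apply Rabs_le_between in Bg. apply Rabs_le_between in Bh. lra.
  - assert (Hpos : 0 < norm y) by (generalize (norm_ge_0 y); lra).
    apply Rnot_lt_le. intros Hlt.
    set (s := (rho + r / norm y) / 2).
    assert (Hrs : rho < r / norm y).
    { apply Rmult_lt_reg_r with (norm y); auto. unfold Rdiv.
      rewrite Rmult_assoc, Rinv_l, Rmult_1_r; auto. }
    assert (s <= rho); [|unfold s in *; lra].
    apply (proj1 MK (scal (/ norm y) y)).
    + eapply Rle_trans; [apply (@norm_scal R_AbsRing E)|]. unfold abs; simpl.
      rewrite Rabs_right, Rinv_l; auto; [lra|].
      apply Rle_ge, Rlt_le, Rinv_0_lt_compat, Hpos.
    + intros k. destruct (Hr k) as [g [h [Hg [Hh Hd]]]].
      exists g, h. split; [auto|split; [auto|]].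
      destruct (chain_unit _ CK _ _ Hg) as [_ [Sg _]].
      destruct (chain_unit _ CK _ _ Hh) as [_ [Sh _]].
      rewrite Sg, Sh. apply Rlt_le_trans with (r / norm y); [unfold s; lra|].
      replace (/ norm y * g y - / norm y * h y)
        with ((g y - h y) / norm y) by (field; auto).
      apply Rmult_le_compat_r; auto. now apply Rlt_le, Rinv_0_lt_compat.
Qed.

(** * The copy of l1 *)

(** The least value of [c * t] when [t] is at least [hi] or at most [lo],
    whichever makes [c * t] large. *)
Definition favourable (c hi lo : R) : R := if Rle_dec 0 c then c * hi else c * lo.

Lemma favourable_opp c hi lo :
  favourable c hi lo + favourable (- c) hi lo = Rabs c * (hi - lo).
Proof.
  unfold favourable. destruct (Rle_dec 0 c), (Rle_dec 0 (- c)).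
  - replace c with 0 by lra. rewrite Rabs_R0. lra.
  - rewrite Rabs_right; lra.
  - rewrite Rabs_left; lra.
  - lra.
Qed.

(** The states of the dependent choice are finite lists of subchains of [K], one
    for each pattern of high and low values on the points chosen so far.  The
    signs of the coefficients select the pattern. *)
Lemma independent_points (dc : dependent_choices) (eps : nat -> R) :
  (forall n, 0 < eps n) ->
  exists (a : nat -> E) (hi lo : nat -> R),
    (forall n, norm (a n) <= 1 /\ rho - eps n <= hi n - lo n) /\
    forall (c : nat -> R) n k, exists g, K k g /\
      forall i, (i <= n)%nat -> favourable (c i) (hi i) (lo i) <= c i * g (a i).
Proof.
  intros Heps.
  destruct (dependent_choices_indexed dc
    (X := list (nat -> (E -> R) -> Prop) * (E * (R * R)))
    (fun _ s => (exists L, In L (fst s)) /\ forall L, In L (fst s) -> subchain L K)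
    (fun n s t =>
       let x := fst (snd t) in
       let hi := fst (snd (snd t)) in
       let lo := snd (snd (snd t)) in
       norm x <= 1 /\ rho - eps n <= hi - lo /\
       forall L, In L (fst s) -> In (above L x hi) (fst t) /\ In (below L x lo) (fst t)))
    as [u Hu].
  - exists (cons K nil, (zero, (0, 0))). simpl. split.
    + exists K. now left.
    + intros L [<-|[]]. now apply subchain_refl.
  - intros n [l z] [[L0 HL0] Hl]; simpl in *.
    destruct (simultaneous_split l (eps n) Hl (Heps n))
      as [x [hi [lo [Hx [Hhl HS]]]]].
    exists (map (fun L => above L x hi) l ++ map (fun L => below L x lo) l,
            (x, (hi, lo))). simpl.
    split; split.
    + exists (above L0 x hi). apply in_or_app. left.
      now apply (in_map (fun L => above L x hi)).
    + intros L HL. apply in_app_or in HL as [HL|HL];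
        apply in_map_iff in HL as [M [<- HM]]; now apply HS.
    + auto.
    + split; auto. intros L HL. split; apply in_or_app; [left|right].
      * now apply (in_map (fun L => above L x hi)).
      * now apply (in_map (fun L => below L x lo)).
  - exists (fun n => fst (snd (u (S n)))), (fun n => fst (snd (snd (u (S n))))),
      (fun n => snd (snd (snd (u (S n))))).
    split; [intros n; split; apply (proj2 (Hu n))|].
    intros c n k.
    assert (Hsel : forall m, exists L, In L (fst (u m)) /\ forall k g, L k g ->
       forall i, (i < m)%nat ->
       favourable (c i) (fst (snd (snd (u (S i))))) (snd (snd (snd (u (S i)))))
         <= c i * g (fst (snd (u (S i))))).
    { induction m as [|m [L [HL IH]]].
      - destruct (proj1 (proj1 (Hu 0%nat))) as [L HL]. exists L. split; auto. lia.
      - destruct (proj2 (proj2 (proj2 (Hu m))) L HL) as [Ha Hb].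
        destruct (Rle_dec 0 (c m)) as [Hc|Hc].
        + eexists. split; [exact Ha|]. intros k' g [Hg Hgx] i Hi.
          destruct (Nat.eq_dec i m) as [->|Him]; [|apply (IH k'); auto; lia].
          unfold favourable. destruct (Rle_dec 0 (c m)); [|lra].
          now apply Rmult_le_compat_l.
        + eexists. split; [exact Hb|]. intros k' g [Hg Hgx] i Hi.
          destruct (Nat.eq_dec i m) as [->|Him]; [|apply (IH k'); auto; lia].
          unfold favourable. destruct (Rle_dec 0 (c m)); [lra|].
          apply Rmult_le_compat_neg_l; lra. }
    destruct (Hsel (S n)) as [L [HL HLg]].
    destruct (proj2 (proj1 (Hu (S n))) L HL) as [CL SL].
    destruct (chain_nonempty _ CL k) as [g Hg].
    exists g. split; auto. intros i Hi. apply (HLg k g Hg). lia.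
Qed.

(** The members [g] and [h] of [K k] realize the pattern given by the signs of
    the coefficients and the opposite pattern, which makes [g - h] large at the
    combination of the points. *)
Lemma l1_copy_of_minimal (dc : dependent_choices) :
  0 < rho -> contains_asymptotically_isometric_l1 E.
Proof.
  intros Hrho.
  assert (Hpos : forall n, 0 < / (INR n + 2)).
  { intros n. apply Rinv_0_lt_compat. generalize (pos_INR n). lra. }
  destruct (independent_points dc (fun n => rho * / (INR n + 2)))
    as [a [hi [lo [Ha Hind]]]].
  { intros n. now apply Rmult_lt_0_compat. }
  (* The shift by 2 keeps [1 - / (INR n + 2)] positive at [n = 0]. *)
  exists a, (fun n => 1 - / (INR n + 2)). split; [|split; [|split]].
  - apply Ha.
  - intros n. specialize (Hpos n). split; [|lra].
    assert (/ (INR n + 2) < 1); [|lra].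
    rewrite <- Rinv_1. generalize (pos_INR n). intros.
    apply Rinv_lt_contravar; lra.
  - replace (Finite 1) with (Finite (1 - 0)) by (f_equal; ring).
    apply is_lim_seq_minus'; [apply is_lim_seq_const|].
    replace (Finite 0) with (Rbar_inv p_infty) by reflexivity.
    apply is_lim_seq_inv; [|easy].
    apply is_lim_seq_plus with p_infty 2; try easy.
    + apply is_lim_seq_INR.
    + apply is_lim_seq_const.
  - intros n c.
    set (y := sum_n (fun i => scal (c i) (a i)) n).
    set (S1 := sum_n (fun i => (1 - / (INR i + 2)) * Rabs (c i)) n).
    apply Rmult_le_reg_l with rho; auto. apply spread_le_norm.
    intros k.
    destruct (Hind c n k) as [g [Hg Hgc]].
    destruct (Hind (fun i => - c i) n k) as [h [Hh Hhc]].
    exists g, h. split; [auto|split; [auto|]].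
    unfold y. rewrite !unit_sum
      by (apply (chain_unit _ CK k); auto).
    unfold S1. clear y S1. revert Hgc Hhc.
    induction n as [|n IH]; intros Hgc Hhc.
    + rewrite !sum_O. specialize (Hgc 0%nat (le_n _)). specialize (Hhc 0%nat (le_n _)).
      generalize (favourable_opp (c 0%nat) (hi 0%nat) (lo 0%nat)).
      generalize (Rmult_le_compat_l _ _ _ (Rabs_pos (c 0%nat)) (proj2 (Ha 0%nat))).
      simpl in *. lra.
    + rewrite !sum_Sn.
      specialize (IH (fun i Hi => Hgc i (le_S _ _ Hi)) (fun i Hi => Hhc i (le_S _ _ Hi))).
      specialize (Hgc (S n) (le_n _)). specialize (Hhc (S n) (le_n _)).
      generalize (favourable_opp (c (S n)) (hi (S n)) (lo (S n))).
      generalize (Rmult_le_compat_l _ _ _ (Rabs_pos (c (S n))) (proj2 (Ha (S n)))).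
      unfold plus in *; simpl in *. lra.
Qed.

End Minimal.

End Chains.
(** * Convex combinations of the tails of a sequence *)

Section Blocks.

Variable E : NormedModule R_AbsRing.

Lemma dual_ball_unit_functional (f : E -> R) :
  in_dual_unit_ball E f -> unit_functional E f.
Proof.
  intros [Hf Hn]. repeat split.
  - apply (linear_plus f Hf).
  - apply (linear_scal f Hf).
  - intros x.
    assert (Hball : forall z, norm z <= 1 -> Rabs (f z) <= 1).
    { intros z Hz.
      assert (H : Rbar_le (Rabs (f z)) 1); [|exact H].
      apply Rbar_le_trans with (2 := Hn). apply Lub_Rbar_correct. now exists z. }
    destruct (Req_dec (norm x) 0) as [H0|H0].
    + rewrite (norm_eq_zero x H0), (linear_zero f Hf).
      rewrite (@norm_zero R_AbsRing E). unfold zero; simpl. rewrite Rabs_R0. lra.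
    + assert (Hpos : 0 < norm x) by (generalize (norm_ge_0 x); lra).
      assert (Hi : 0 < / norm x) by now apply Rinv_0_lt_compat.
      apply Rmult_le_reg_l with (/ norm x); auto. rewrite Rinv_l by auto.
      replace (/ norm x * Rabs (f x)) with (Rabs (f (scal (/ norm x) x))).
      * apply Hball. eapply Rle_trans; [apply (@norm_scal R_AbsRing E)|].
        unfold abs; simpl. rewrite Rabs_right, Rinv_l; auto; lra.
      * rewrite (linear_scal f Hf). unfold scal; simpl. unfold mult; simpl.
        rewrite Rabs_mult, (Rabs_right (/ norm x)); lra.
Qed.

(** The coefficients are indexed by all natural numbers and vanish outside
    [[k, l]]: two combinations then have the common range [[k, max l l']], over
    which they can be averaged. *)
Definition convex_combination (f : nat -> E -> R) (k l : nat) (c : nat -> R)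
    (g : E -> R) : Prop :=
  (forall i, 0 <= c i) /\ (forall i, (i < k)%nat -> c i = 0) /\
  (forall i, (l < i)%nat -> c i = 0) /\ sum_n c l = 1 /\
  forall x, g x = sum_n (fun i => c i * f i x) l.

Definition tail_hull (f : nat -> E -> R) (k : nat) (g : E -> R) : Prop :=
  exists l c, convex_combination f k l c g.

Lemma sum_n_extend (a : nat -> R) l m : (l <= m)%nat ->
  (forall i, (l < i)%nat -> a i = 0) -> sum_n a m = sum_n a l.
Proof.
  intros Hlm Ha. induction Hlm; auto.
  rewrite sum_Sn, IHHlm, (Ha (S m)) by lia. unfold plus; simpl. ring.
Qed.

Lemma convex_combination_extend f k l m c g : (l <= m)%nat ->
  convex_combination f k l c g -> convex_combination f k m c g.
Proof.
  intros Hlm [H1 [H2 [H3 [H4 H5]]]].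
  split; [auto|]. split; [auto|]. split; [intros; apply H3; lia|]. split.
  - now rewrite (sum_n_extend c l m).
  - intros x. rewrite H5. symmetry. apply sum_n_extend; auto.
    intros i Hi. rewrite H3 by auto. ring.
Qed.

Lemma sum_n_midpoint (a b : nat -> R) l :
  sum_n (fun i => (a i + b i) / 2) l = (sum_n a l + sum_n b l) / 2.
Proof.
  induction l as [|l IH].
  - now rewrite !sum_O.
  - rewrite !sum_Sn, IH. unfold plus; simpl. lra.
Qed.

Lemma unit_convex_combination f k l c g :
  (forall n, unit_functional E (f n)) -> convex_combination f k l c g ->
  unit_functional E g.
Proof.
  intros Hf [H1 [_ [_ [H4 H5]]]]. repeat split.
  - intros x y. rewrite !H5. clear H4 H5. induction l as [|l IH].
    + rewrite !sum_O, (proj1 (Hf 0%nat)). lra.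
    + rewrite !sum_Sn, IH, (proj1 (Hf (S l))). unfold plus; simpl. lra.
  - intros t x. rewrite !H5. clear H4 H5. induction l as [|l IH].
    + rewrite !sum_O, (proj1 (proj2 (Hf 0%nat))). lra.
    + rewrite !sum_Sn, IH, (proj1 (proj2 (Hf (S l)))). unfold plus; simpl. lra.
  - intros x. rewrite H5. replace (norm x) with (sum_n c l * norm x) by (rewrite H4; ring).
    clear H4 H5. assert (B := fun i => proj2 (proj2 (Hf i)) x).
    induction l as [|l IH].
    + rewrite !sum_O, Rabs_mult, (Rabs_right (c 0%nat)) by (apply Rle_ge; auto).
      now apply Rmult_le_compat_l.
    + rewrite !sum_Sn. unfold plus; simpl.
      eapply Rle_trans; [apply Rabs_triang|].
      rewrite Rmult_plus_distr_r. apply Rplus_le_compat; auto.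
      rewrite Rabs_mult, (Rabs_right (c (S l))) by (apply Rle_ge; auto).
      now apply Rmult_le_compat_l.
Qed.

Lemma sum_n_delta (k : nat) (a : nat -> R) :
  sum_n (fun i => (if Nat.eq_dec i k then 1 else 0) * a i) k = a k.
Proof.
  assert (Hz : forall m, (m < k)%nat ->
    sum_n (fun i => (if Nat.eq_dec i k then 1 else 0) * a i) m = 0).
  { induction m as [|m IH]; intros Hm.
    - rewrite sum_O. destruct (Nat.eq_dec 0 k); [lia|apply Rmult_0_l].
    - rewrite sum_Sn, IH by lia. destruct (Nat.eq_dec (S m) k); [lia|].
      unfold plus; simpl. ring. }
  destruct k as [|k].
  - rewrite sum_O. destruct (Nat.eq_dec 0 0); [apply Rmult_1_l|lia].
  - rewrite sum_Sn, Hz by lia. destruct (Nat.eq_dec (S k) (S k)); [|lia].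
    unfold plus; simpl. ring.
Qed.

Lemma tail_hull_chain f :
  (forall n, unit_functional E (f n)) -> chain E (tail_hull f).
Proof.
  intros Hf. split.
  - intros k. exists (f k), k, (fun i => if Nat.eq_dec i k then 1 else 0).
    repeat split.
    + intros i. destruct (Nat.eq_dec i k); lra.
    + intros i Hi. destruct (Nat.eq_dec i k); [lia|auto].
    + intros i Hi. destruct (Nat.eq_dec i k); [lia|auto].
    + eapply eq_trans; [|apply (sum_n_delta k (fun _ => 1))]. apply sum_n_ext.
      intros i. symmetry. apply Rmult_1_r.
    + intros x. symmetry. apply (sum_n_delta k (fun i => f i x)).
  - intros k g [l [c [H1 [H2 H3]]]]. exists l, c.
    split; [auto|split; auto].
  - intros k g h [l [c Hg]] [m [d Hh]].
    apply (convex_combination_extend _ _ _ (max l m)) in Hg; [|lia].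
    apply (convex_combination_extend _ _ _ (max l m)) in Hh; [|lia].
    destruct Hg as [G1 [G2 [G3 [G4 G5]]]]. destruct Hh as [H1 [H2 [H3 [H4 H5]]]].
    exists (max l m), (fun i => (c i + d i) / 2). repeat split.
    + intros i. specialize (G1 i). specialize (H1 i). lra.
    + intros i Hi. rewrite G2, H2 by auto. lra.
    + intros i Hi. rewrite G3, H3 by auto. lra.
    + rewrite sum_n_midpoint, G4, H4. lra.
    + intros x. unfold midpoint. rewrite G5, H5, <- sum_n_midpoint.
      apply sum_n_ext. intros i.
      change ((c i * f i x + d i * f i x) / 2 = (c i + d i) / 2 * f i x). lra.
  - intros k g [l [c Hc]]. now apply (unit_convex_combination f k l c).
Qed.

Lemma convex_combination_le f k l c g : convex_combination f k l c g -> (k <= l)%nat.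
Proof.
  intros [_ [H2 [_ [H4 _]]]]. apply Nat.nlt_ge. intros Hlt.
  assert (H0 : forall m, (m < k)%nat -> sum_n c m = 0).
  { induction m as [|m IH]; intros Hm; [rewrite sum_O; auto|].
    rewrite sum_Sn, IH, H2 by lia. unfold plus; simpl. ring. }
  rewrite H0 in H4 by auto. lra.
Qed.

Lemma iter_Rplus_app (a : nat -> R) s t :
  Iter.iter Rplus 0 (s ++ t) a = Iter.iter Rplus 0 s a + Iter.iter Rplus 0 t a.
Proof.
  induction s as [|i s IH]; simpl; [|rewrite IH]; ring.
Qed.

Lemma iter_Rplus_ext (a b : nat -> R) s :
  (forall i, In i s -> a i = b i) ->
  Iter.iter Rplus 0 s a = Iter.iter Rplus 0 s b.
Proof.
  induction s as [|i s IH]; intros H; simpl; auto.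
  rewrite IH, (H i) by auto with datatypes. reflexivity.
Qed.

Lemma iter_seq_sum_n (a : nat -> R) k l : (k <= l)%nat ->
  (forall i, (i < k)%nat -> a i = 0) ->
  Iter.iter Rplus 0 (seq k (S l - k)) a = sum_n a l.
Proof.
  intros Hkl Ha.
  assert (Hfull : Iter.iter Rplus 0 (seq 0 (S l)) a = sum_n a l).
  { clear. induction l as [|l IH].
    - rewrite sum_O. apply Rplus_0_r.
    - rewrite seq_S, iter_Rplus_app, IH, sum_Sn. apply f_equal, Rplus_0_r. }
  rewrite <- Hfull. replace (S l) with (k + (S l - k))%nat at 2 by lia.
  rewrite seq_app, iter_Rplus_app, (iter_Rplus_ext a (fun _ => 0) (seq 0 k)).
  - assert (Hz : forall s : list nat, Iter.iter Rplus 0 s (fun _ => 0) = 0).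
    { induction s as [|i s IH]; simpl; [|rewrite IH]; ring. }
    rewrite Hz. simpl. ring.
  - intros i Hi. apply in_seq in Hi. apply Ha. lia.
Qed.

Lemma iter_functions_on (f : nat -> E -> R) (c : nat -> R) s x :
  Iter.iter (@plus (functions_on E)) zero s (fun i => scal (c i) (f i : functions_on E)) x
  = Iter.iter Rplus 0 s (fun i => c i * f i x).
Proof.
  induction s as [|i s IH]; [reflexivity|]. simpl. rewrite <- IH. reflexivity.
Qed.

(** Once [b n] is chosen with coefficients supported in [[k, l]], [b (n + 1)] is
    chosen in [K (l + 1)], hence with a support beyond [l].  The supports being
    disjoint, the coefficients of all the blocks merge into one sequence. *)
Lemma block_selection (dc : dependent_choices) f K :
  subchain E K (tail_hull f) ->
  exists b, (forall n, K n (b n)) /\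
    normalized_block_sequence (V := functions_on E) f b.
Proof.
  intros [CK SK].
  destruct (dependent_choices_indexed dc
    (X := (nat * nat) * ((nat -> R) * (E -> R)))
    (fun n s => (n <= fst (fst s))%nat /\ K (fst (fst s)) (snd (snd s)) /\
       convex_combination f (fst (fst s)) (snd (fst s)) (fst (snd s)) (snd (snd s)))
    (fun _ s t => (snd (fst s) < fst (fst t))%nat)) as [u Hu].
  - destruct (chain_nonempty _ _ CK 0%nat) as [g Hg].
    destruct (SK _ _ Hg) as [l [c Hc]]. now exists ((0%nat, l), (c, g)).
  - intros n [[k l] [c g]] [Hn [Hg Hc]]; simpl in *.
    destruct (chain_nonempty _ _ CK (S l)) as [h Hh].
    destruct (SK _ _ Hh) as [m [d Hd]]. exists ((S l, m), (d, h)); simpl.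
    apply convex_combination_le in Hc. repeat split; auto; lia || apply Hd.
  - set (first n := fst (fst (u n))). set (final n := snd (fst (u n))).
    set (c n := fst (snd (u n))). set (b n := snd (snd (u n))).
    assert (Hc : forall n, convex_combination f (first n) (final n) (c n) (b n))
      by (intros n; apply (proj1 (Hu n))).
    assert (Hle : forall n, (first n <= final n)%nat)
      by (intros n; apply (convex_combination_le f _ _ (c n) (b n)), Hc).
    assert (Hlt : forall m n, (m < n)%nat -> (final m < first n)%nat).
    { intros m n Hmn. induction Hmn as [|n Hmn IH]; [apply (proj2 (Hu m))|].
      specialize (Hle n). assert (final n < first (S n))%nat by apply (proj2 (Hu n)).
      lia. }
    destruct (countable_choice dc (fun i r =>
      forall n, (first n <= i <= final n)%nat -> r = c n i)) as [lambda Hlambda].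
    (* The value 0 off the supports is arbitrary. *)
    { intros i. destruct (classic (exists n, (first n <= i <= final n)%nat))
        as [[n Hn]|Hno].
      - exists (c n i). intros m Hm. destruct (Nat.lt_total m n) as [H|[->|H]]; auto.
        + specialize (Hlt _ _ H). lia.
        + specialize (Hlt _ _ H). lia.
      - exists 0. intros n Hn. exfalso. apply Hno. now exists n. }
    assert (Hin : forall n i, In i (seq (first n) (S (final n) - first n)) ->
      (first n <= i <= final n)%nat).
    { intros n i Hi. apply in_seq in Hi. specialize (Hle n). lia. }
    exists b. split.
    + intros n. apply (chain_le E _ CK) with (first n); apply (proj1 (Hu n)).
    + exists (fun n => seq (first n) (S (final n) - first n)), lambda.
      split; [|split].
      * intros n. apply seq_NoDup.
      * intros m n Hmn i Hm Hn. apply Hin in Hm. apply Hin in Hn.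
        destruct (Nat.lt_total m n) as [H|[->|H]]; try specialize (Hlt _ _ H); lia.
      * intros n. destruct (Hc n) as [H1 [H2 [H3 [H4 H5]]]]. split.
        -- apply functional_extensionality. intros x. rewrite H5.
           rewrite iter_functions_on.
           rewrite (iter_Rplus_ext _ (fun i => c n i * f i x)).
           ++ rewrite iter_seq_sum_n; auto.
              intros i Hi. rewrite H2 by auto. ring.
           ++ intros i Hi. now rewrite (Hlambda i n (Hin n i Hi)).
        -- rewrite (iter_Rplus_ext _ (c n)).
           ++ rewrite iter_seq_sum_n; auto.
           ++ intros i Hi. rewrite (Hlambda i n (Hin n i Hi)).
              apply Rabs_right, Rle_ge, H1.
Qed.

(** * Pointwise limits of functionals *)

Lemma weak_star_limit (b : nat -> E -> R) :
  (forall n, unit_functional E (b n)) ->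
  (forall x, norm x <= 1 -> forall eps, 0 < eps ->
     exists N, forall m n, (N <= m)%nat -> (N <= n)%nat -> b m x - b n x <= eps) ->
  exists g, in_dual E g /\ weak_star_converges E b g.
Proof.
  intros Hb Hball.
  assert (Hlim : forall x, is_lim_seq (fun n => b n x) (real (Lim_seq (fun n => b n x)))).
  { intros x. apply Lim_seq_correct', ex_lim_seq_cauchy_corr.
    intros eps. set (t := norm x + 1).
    assert (Ht : 0 < t) by (generalize (norm_ge_0 x); unfold t; lra).
    assert (Hi : 0 < / t) by now apply Rinv_0_lt_compat.
    (* [norm x + 1], rather than [norm x], avoids the case of the zero vector. *)
    destruct (Hball (scal (/ t) x)) with (eps := eps / 2 * / t) as [N HN].
    - eapply Rle_trans; [apply (@norm_scal R_AbsRing E)|].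
      unfold abs; simpl. rewrite Rabs_right by lra.
      apply Rmult_le_reg_l with t; auto. rewrite <- Rmult_assoc, Rinv_r by lra.
      unfold t; lra.
    - apply Rmult_lt_0_compat; auto. apply (cond_pos (mkposreal _ (is_pos_div_2 eps))).
    - assert (Hmn : forall m n, (N <= m)%nat -> (N <= n)%nat -> b m x - b n x <= eps / 2).
      { intros m n Hm Hn. specialize (HN m n Hm Hn).
        rewrite (proj1 (proj2 (Hb m))), (proj1 (proj2 (Hb n))) in HN.
        apply Rmult_le_reg_l with (/ t); auto. lra. }
      exists N. intros n m Hn Hm. generalize (cond_pos eps). intros Heps.
      apply Rabs_lt_between. generalize (Hmn n m Hn Hm) (Hmn m n Hm Hn). lra. }
  exists (fun x => real (Lim_seq (fun n => b n x))). split; [split|exact Hlim].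
  - intros x y.
    assert (H := is_lim_seq_plus' _ _ _ _ (Hlim x) (Hlim y)).
    apply (is_lim_seq_ext _ (fun n => b n (plus x y))) in H.
    + now rewrite (is_lim_seq_unique _ _ H).
    + intros n. symmetry. apply Hb.
  - intros t x.
    assert (H := is_lim_seq_scal_l _ t _ (Hlim x)).
    apply (is_lim_seq_ext _ (fun n => b n (scal t x))) in H.
    + now rewrite (is_lim_seq_unique _ _ H).
    + intros n. symmetry. apply Hb.
  - exists 1. split; [lra|]. intros x. rewrite Rmult_1_l.
    assert (H := is_lim_seq_abs _ _ (Hlim x)).
    apply (is_lim_seq_le _ _ _ (norm x) (fun n => proj2 (proj2 (Hb n)) x) H).
    apply is_lim_seq_const.
Qed.

End Blocks.

(** * Block compactness of the dual ball *)

Theorem theorem2 (dc : dependent_choices) (E : NormedModule R_AbsRing)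
  (hE : ~ contains_asymptotically_isometric_l1 E) :
  dual_ball_weak_star_block_compact E.
Proof.
  intros f Hf.
  assert (Hunit : forall n, unit_functional E (f n))
    by (intros n; now apply dual_ball_unit_functional).
  destruct (oscillation_minimal_subchain E dc (tail_hull E f)) as [K [rho [HK HM]]].
  { now apply tail_hull_chain. }
  assert (Hrho : rho <= 0).
  { apply Rnot_lt_le. intros Hrho. apply hE.
    now apply (l1_copy_of_minimal E K rho (proj1 HK) HM dc). }
  destruct (block_selection E dc f K HK) as [b [HbK Hblock]].
  exists b. split; auto. apply weak_star_limit.
  - intros n. apply (chain_unit _ _ (proj1 HK) n), HbK.
  - intros x Hx eps Heps.
    destruct (eventually_spread_le E K rho (proj1 HK) HM x eps Hx Heps) as [N HN].
    exists N. intros m n Hm Hn.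
    assert (b m x - b n x <= rho + eps); [|lra].
    apply (HN N); auto.
    + now apply (chain_le E _ (proj1 HK)) with m.
    + now apply (chain_le E _ (proj1 HK)) with n.
Qed.
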